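(* Let $R$ be a commutative ring and let $\iota : R \to I(R)$ be the positive valuation $\iota(r) = (r)$. (1) $\iota$ is initial among positive valuations of $R$ whose codomain is $|R|$-complete: for every $|R|$-complete idempotent semiring $\Gamma$ and every positive valuation $\nu : R \to \Gamma$ there exists a unique semiring homomorphism $\varphi : I(R) \to \Gamma$ preserving all sums of size at most $|R|$ such that $\nu = \varphi \circ \iota$. (2) If $R$ is Noetherian, then $\iota$ is initial among all positive valuations of $R$: for every idempotent semiring $\Gamma$ and every positive valuation $\nu : R \to \Gamma$ there exists a unique semiring homomorphism $\varphi : I(R) \to \Gamma$ such that $\nu = \varphi \circ \iota$.
   Context: Rings and semirings are unital. A semiring $(S,+,*,0,1)$ has commutative additive monoid $(S,+,0)$, multiplicative monoid $(S,*,1)$ (not necessarily commutative), multiplication distributing over addition on both sides, and $0$ annihilating. Semiring homomorphisms preserve $+,*,0,1$. A semiring is idempotent if $a+a=a$ for all $a$; it then carries the partial order $a\le b \iff a+b=a$ (so $a+b$ is the infimum of $a,b$, and $0$ is the greatest element). For a cardinal $\kappa$, an idempotent semiring $\Gamma$ is $\kappa$-complete if sums $\sum_{i\in I} b_i$ exist for all families with $|I|\le\kappa$, are the infima for $\le$, are compatible with partitions of the index set, extend the finite sums, and satisfy $a*\sum_i b_i=\sum_i a*b_i$ and $(\sum_i b_i)*a=\sum_i b_i*a$. A valuation on a ring $R$ with values in an idempotent semiring $\Gamma$ is a map $\nu:R\to\Gamma$ with $\nu(0)=0$, $\nu(1)=1$, $\nu(-1)=1$, $\nu(ab)=\nu(a)\nu(b)$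 and $\nu(a+b)\ge\nu(a)+\nu(b)$. It is positive if $\nu(r)\ge 1_\Gamma$ for all $r\in R$. For a commutative ring $R$, $I(R)$ is the idempotent semiring of ideals of $R$, with (arbitrary) sum and finite product of ideals as operations, zero element $(0)$ and unit $(1)$; its order is $I\le J\iff I\supseteq J$. *)

(* Defs.v *)
From HB Require Import structures.
From mathcomp Require Import all_boot all_order all_algebra.
From mathcomp Require Import mathcomp_extra boolp classical_sets functions.
From mathcomp Require Import cardinality.

Set Implicit Arguments.
Unset Strict Implicit.
Unset Printing Implicit Defensive.

Import GRing.Theory.

Local Open Scope classical_set_scope.
Local Open Scope card_scope.
Local Open Scope ring_scope.

(* The ring and semiring structures are the "pz" ones (0 = 1 is allowed), and
   multiplication is not assumed commutative unless stated. *)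
HB.mixin Record isAddIdempotent G of GRing.PzSemiRing G := {
  addr_idem : forall a : G, a + a = a
}.

#[short(type="idemSemiRingType")]
HB.structure Definition IdemSemiRing :=
  {G of GRing.PzSemiRing G & isAddIdempotent G}.

(* For this order a + b is the infimum of a and b, and 0 is the greatest
   element. *)
Definition idem_le (G : idemSemiRingType) (a b : G) : Prop := a + b = a.

(* The cardinal kappa is represented by a type K.  The operation [bigsum] is a
   total function on families indexed by any type, but it is constrained only on
   families of size at most |K|. *)
HB.mixin Record isComplete (K : Type) G of IdemSemiRing G := {
  bigsum : forall I : Type, (I -> G) -> G;
  bigsum_lb : forall I : Type, [set: I] #<= [set: K] ->
    forall (b : I -> G) (i : I), idem_le (bigsum I b) (b i);
  bigsum_glb : forall I : Type, [set: I] #<= [set: K] ->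
    forall (b : I -> G) (c : G),
      (forall i, idem_le c (b i)) -> idem_le c (bigsum I b);
  (* A partition of I is given by the fibres of a map I -> J. *)
  bigsum_partition : forall (I J : Type) (p : I -> J),
    [set: I] #<= [set: K] -> [set: J] #<= [set: K] ->
    forall b : I -> G,
      bigsum I b =
      bigsum J (fun j => bigsum {i : I | p i = j} (fun i => b (sval i)));
  bigsum_fin : forall I : finType, [set: I] #<= [set: K] ->
    forall b : I -> G, bigsum I b = \sum_(i : I) b i;
  mulr_bigsumr : forall I : Type, [set: I] #<= [set: K] ->
    forall (a : G) (b : I -> G), a * bigsum I b = bigsum I (fun i => a * b i);
  mulr_bigsuml : forall I : Type, [set: I] #<= [set: K] ->
    forall (a : G) (b : I -> G), bigsum I b * a = bigsum I (fun i => b i * a)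
}.

#[short(type="completeSemiRingType")]
HB.structure Definition CompleteSemiRing (K : Type) :=
  {G of IdemSemiRing G & isComplete K G}.

Definition preserves_bigsum (K : Type) (G H : completeSemiRingType K)
    (f : G -> H) : Prop :=
  forall I : Type, [set: I] #<= [set: K] ->
    forall b : I -> G, f (bigsum I b) = bigsum I (f \o b).

Record valuation (R : pzRingType) (G : idemSemiRingType) (v : R -> G) : Prop :=
  Valuation {
    valuation0 : v 0 = 0;
    valuation1 : v 1 = 1;
    valuationN1 : v (-1) = 1;
    valuationM : forall a b, v (a * b) = v a * v b;
    valuationD : forall a b, idem_le (v a + v b) (v (a + b))
  }.

Definition positive_valuation (R : pzRingType) (G : idemSemiRingType)
    (v : R -> G) : Prop :=
  valuation v /\ forall r, idem_le 1 (v r).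

(* MathComp's [idealr] only covers proper decidable ideals. *)
Record ideal_closed (R : comPzRingType) (I : set R) : Prop := IdealClosed {
  ideal_closed0 : I 0;
  ideal_closedD : forall x y, I x -> I y -> I (x + y);
  ideal_closedM : forall r x, I x -> I (r * x)
}.

Record ideal (R : comPzRingType) := Ideal {
  ideal_set :> set R;
  idealP : ideal_closed ideal_set
}.

Section Ideals.
Variable R : comPzRingType.
Implicit Types (A : set R) (I J L : ideal R).

Lemma ideal_closed_smallest A : ideal_closed (smallest (@ideal_closed R) A).
Proof.
split=> [B [BI _]|x y xA yA B BA|r x xA B BA]; first exact: ideal_closed0.
- by apply: (ideal_closedD BA.1); [apply: xA|apply: yA].
- by apply: (ideal_closedM BA.1); apply: xA.
Qed.

Definition ideal_span A : ideal R := Ideal (ideal_closed_smallest A).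

Lemma ideal_ext I J : I `<=` J -> J `<=` I -> I = J.
Proof.
case: I J => [I Iid] [J Jid] /= IJ JI.
have E : I = J by apply/seteqP.
by rewrite {}E in Iid IJ JI *; congr Ideal; exact: Prop_irrelevance.
Qed.

Lemma sub_ideal_span A : A `<=` ideal_span A.
Proof. exact: sub_gen_smallest. Qed.

Lemma ideal_span_sub A I : A `<=` I -> ideal_span A `<=` I.
Proof. by move=> AI; apply: smallest_sub => //; exact: idealP. Qed.

Lemma ideal_spanS A B : A `<=` B -> ideal_span A `<=` ideal_span B.
Proof. by move=> AB; apply: ideal_span_sub => x /AB; exact: sub_ideal_span. Qed.

Definition ideal0 : ideal R := ideal_span [set 0].
Definition ideal1 : ideal R := ideal_span [set 1].
Definition ideal_add I J : ideal R := ideal_span (I `|` J).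
Definition ideal_sum (T : Type) (F : T -> ideal R) : ideal R :=
  ideal_span (\bigcup_t F t).
Definition ideal_mul I J : ideal R :=
  ideal_span [set x * y | x in I & y in J].

Lemma ideal0_sub I : ideal0 `<=` I.
Proof. by apply: ideal_span_sub => _ ->; exact: (ideal_closed0 (idealP I)). Qed.

Lemma sub_ideal1 I : I `<=` ideal1.
Proof.
move=> x _; rewrite -[x]mulr1; apply: (ideal_closedM (idealP ideal1)).
exact: sub_ideal_span.
Qed.

Lemma ideal_addl I J : I `<=` ideal_add I J.
Proof. by move=> x Ix; apply: sub_ideal_span; left. Qed.

Lemma ideal_addr I J : J `<=` ideal_add I J.
Proof. by move=> x Ix; apply: sub_ideal_span; right. Qed.

Lemma ideal_add_sub I J L : I `<=` L -> J `<=` L -> ideal_add I J `<=` L.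
Proof. by move=> IL JL; apply: ideal_span_sub => x [/IL|/JL]. Qed.

Lemma ideal_sum_ub (T : Type) (F : T -> ideal R) t : F t `<=` ideal_sum F.
Proof. by move=> x Ftx; apply: sub_ideal_span; exists t. Qed.

Lemma ideal_sum_sub (T : Type) (F : T -> ideal R) L :
  (forall t, F t `<=` L) -> ideal_sum F `<=` L.
Proof. by move=> FL; apply: ideal_span_sub => x [t _ /FL]. Qed.

Lemma mem_ideal_mul I J x y :
  ideal_set I x -> ideal_set J y -> ideal_set (ideal_mul I J) (x * y).
Proof. by move=> Ix Jy; apply: sub_ideal_span; exists x => //; exists y. Qed.

Lemma ideal_mul_sub I J L :
  (forall x y, ideal_set I x -> ideal_set J y -> ideal_set L (x * y)) ->
  ideal_mul I J `<=` L.
Proof. by move=> IJL; apply: ideal_span_sub => _ [x Ix [y Jy <-]]; exact: IJL. Qed.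

Lemma ideal_closed_quo A L :
  ideal_closed [set x | forall y, A y -> ideal_set L (x * y)].
Proof.
have [L0 LD LM] := idealP L; split=> [y _|x1 x2 H1 H2 y Ay|r x H y Ay].
- by rewrite mul0r.
- by rewrite mulrDl; apply: LD; [apply: H1|apply: H2].
- by rewrite -mulrA; apply: LM; apply: H.
Qed.

(* The colon ideal (L : A). *)
Definition ideal_quo A L : ideal R := Ideal (@ideal_closed_quo A L).

Lemma ideal_mul_span_sub A B L :
  (forall x y, A x -> B y -> ideal_set L (x * y)) ->
  ideal_mul (ideal_span A) (ideal_span B) `<=` L.
Proof.
move=> H; apply: ideal_mul_sub => x y xA yB.
have: ideal_span A `<=` ideal_quo (ideal_span B) L.
  apply: ideal_span_sub => a Aa b bB.
  rewrite mulrC.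
  have: ideal_span B `<=` ideal_quo A L.
    by apply: ideal_span_sub => d Bd c Ac; rewrite mulrC; exact: H.
  by move/(_ b bB a Aa).
by move/(_ x xA y yB).
Qed.

Lemma ideal_addA : associative ideal_add.
Proof.
move=> I J L; apply: ideal_ext.
- apply: ideal_add_sub.
    by move=> x ?; apply: ideal_addl; exact: ideal_addl.
  apply: ideal_add_sub; last exact: ideal_addr.
  by move=> x ?; apply: ideal_addl; exact: ideal_addr.
- apply: ideal_add_sub; last by move=> x ?; apply: ideal_addr; exact: ideal_addr.
  apply: ideal_add_sub; first exact: ideal_addl.
  by move=> x ?; apply: ideal_addr; exact: ideal_addl.
Qed.

Lemma ideal_addC : commutative ideal_add.
Proof.
by move=> I J; apply: ideal_ext; apply: ideal_add_sub;
  (exact: ideal_addl || exact: ideal_addr).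
Qed.

Lemma ideal_add0 : left_id ideal0 ideal_add.
Proof.
move=> I; apply: ideal_ext; last exact: ideal_addr.
by apply: ideal_add_sub => //; exact: ideal0_sub.
Qed.

Lemma ideal_addI : idempotent_op ideal_add.
Proof.
by move=> I; apply: ideal_ext; [exact: ideal_add_sub|exact: ideal_addl].
Qed.

Lemma ideal_mulC : commutative ideal_mul.
Proof.
by move=> I J; apply: ideal_ext; apply: ideal_mul_sub => x y Ix Jy;
  rewrite mulrC; exact: mem_ideal_mul.
Qed.

Lemma ideal_mulA : associative ideal_mul.
Proof.
have sub I J L : ideal_mul I (ideal_mul J L) `<=` ideal_mul (ideal_mul I J) L.
  have -> : I = ideal_span I :> ideal R.
    apply: ideal_ext; [exact: sub_ideal_span|exact: ideal_span_sub].
  apply: ideal_mul_span_sub => x _ Ix [y Jy [z Lz <-]]; rewrite mulrA.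
  by do 2?[apply: mem_ideal_mul] => //; exact: sub_ideal_span.
move=> I J L; apply: ideal_ext; first exact: sub.
rewrite ideal_mulC (ideal_mulC I J) (ideal_mulC I) (ideal_mulC J L).
exact: sub.
Qed.

Lemma ideal_mul1 : left_id ideal1 ideal_mul.
Proof.
move=> I; apply: ideal_ext.
  by apply: ideal_mul_sub => x y _; exact: (ideal_closedM (idealP I)).
by move=> x Ix; rewrite -[x]mul1r; apply: mem_ideal_mul => //; exact: sub_ideal_span.
Qed.

Lemma ideal_mulr1 : right_id ideal1 ideal_mul.
Proof. by move=> I; rewrite ideal_mulC ideal_mul1. Qed.

Lemma ideal_mul0 : left_zero ideal0 ideal_mul.
Proof.
move=> I; apply: ideal_ext; last exact: ideal0_sub.
by apply: ideal_mul_sub => x y I0 _; rewrite mulrC; exact: (ideal_closedM (idealP _)).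
Qed.

Lemma ideal_mulr0 : right_zero ideal0 ideal_mul.
Proof. by move=> I; rewrite ideal_mulC ideal_mul0. Qed.

Lemma ideal_mul_sumr (T : Type) J (F : T -> ideal R) :
  ideal_mul J (ideal_sum F) = ideal_sum (fun t => ideal_mul J (F t)).
Proof.
apply: ideal_ext.
- have {1}-> : J = ideal_span J :> ideal R.
    by apply: ideal_ext; [exact: sub_ideal_span|exact: ideal_span_sub].
  apply: ideal_mul_span_sub => x y Jx [t _ Fty].
  by apply: (ideal_sum_ub (t := t)); exact: mem_ideal_mul.
- apply: ideal_sum_sub => t; apply: ideal_mul_sub => x y Jx Fty.
  by apply: mem_ideal_mul => //; exact: (ideal_sum_ub (t := t)).
Qed.

Lemma ideal_add_sum I J :
  ideal_add I J = ideal_sum (fun b : bool => if b then I else J).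
Proof.
apply: ideal_ext.
- apply: ideal_add_sub => x ?; first exact: (ideal_sum_ub (t := true)).
  exact: (ideal_sum_ub (t := false)).
- by apply: ideal_sum_sub => -[]; [exact: ideal_addl|exact: ideal_addr].
Qed.

Lemma ideal_mulDr : right_distributive ideal_mul ideal_add.
Proof.
move=> L I J; rewrite !ideal_add_sum ideal_mul_sumr.
by congr ideal_sum; apply: funext; case.
Qed.

Lemma ideal_mulDl : left_distributive ideal_mul ideal_add.
Proof. by move=> I J L; rewrite !(ideal_mulC _ L) ideal_mulDr. Qed.

End Ideals.

HB.instance Definition _ (R : comPzRingType) := gen_eqMixin (ideal R).
HB.instance Definition _ (R : comPzRingType) := gen_choiceMixin (ideal R).
HB.instance Definition _ (R : comPzRingType) :=
  GRing.isPzSemiRing.Build (ideal R)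
    (@ideal_addA R) (@ideal_addC R) (@ideal_add0 R)
    (@ideal_mulA R) (@ideal_mul1 R) (@ideal_mulr1 R)
    (@ideal_mulDl R) (@ideal_mulDr R) (@ideal_mul0 R) (@ideal_mulr0 R).
HB.instance Definition _ (R : comPzRingType) :=
  isAddIdempotent.Build (ideal R) (@ideal_addI R).

Section IdealComplete.
Variables (R : comPzRingType) (K : Type).
Implicit Types I J L : ideal R.

Lemma ideal_le_sub I J : idem_le I J <-> J `<=` I.
Proof.
split=> [<-|JI]; first exact: ideal_addr.
by apply: ideal_ext; [exact: ideal_add_sub|exact: ideal_addl].
Qed.

Let sum_lb (T : Type) (_ : [set: T] #<= [set: K]) (F : T -> ideal R) t :
  idem_le (ideal_sum F) (F t).
Proof. by apply/ideal_le_sub; exact: ideal_sum_ub. Qed.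

Let sum_glb (T : Type) (_ : [set: T] #<= [set: K]) (F : T -> ideal R) L :
  (forall t, idem_le L (F t)) -> idem_le L (ideal_sum F).
Proof.
by move=> LF; apply/ideal_le_sub; apply: ideal_sum_sub => t; exact/ideal_le_sub.
Qed.

Let sum_partition (T U : Type) (p : T -> U) (_ : [set: T] #<= [set: K])
    (_ : [set: U] #<= [set: K]) (F : T -> ideal R) :
  ideal_sum F =
  ideal_sum (fun u => ideal_sum (fun t : {t : T | p t = u} => F (sval t))).
Proof.
apply: ideal_ext; apply: ideal_sum_sub => t.
- move=> x Fx; apply: (ideal_sum_ub (t := p t)).
  exact: (ideal_sum_ub (t := exist _ t erefl)).
- by apply: ideal_sum_sub => -[t' _] /=; exact: ideal_sum_ub.
Qed.

Let sum_fin (T : finType) (_ : [set: T] #<= [set: K]) (F : T -> ideal R) :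
  ideal_sum F = \sum_(t : T) F t.
Proof.
apply: ideal_ext.
- by apply: ideal_sum_sub => t; rewrite (bigD1 t) //=; exact: ideal_addl.
- elim/big_ind: _ => [|I J HI HJ|t _]; first exact: ideal0_sub.
  + exact: ideal_add_sub.
  + exact: ideal_sum_ub.
Qed.

Let sum_mulr (T : Type) (_ : [set: T] #<= [set: K]) I (F : T -> ideal R) :
  I * ideal_sum F = ideal_sum (fun t => I * F t).
Proof. exact: ideal_mul_sumr. Qed.

Let sum_mull (T : Type) (_ : [set: T] #<= [set: K]) I (F : T -> ideal R) :
  ideal_sum F * I = ideal_sum (fun t => F t * I).
Proof.
transitivity (I * ideal_sum F); first exact: ideal_mulC.
rewrite [LHS]ideal_mul_sumr; congr ideal_sum.
by apply: funext => t; exact: ideal_mulC.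
Qed.

HB.instance Definition _ := isComplete.Build K (ideal R)
  sum_lb sum_glb sum_partition sum_fin sum_mulr sum_mull.

End IdealComplete.

Definition principal_ideal (R : comPzRingType) (r : R) : ideal R :=
  ideal_span [set r].

Lemma principal_ideal_positive (R : comPzRingType) :
  positive_valuation (@principal_ideal R).
Proof.
split; last by move=> r; apply/ideal_le_sub; exact: sub_ideal1.
split=> // [|a b|a b].
- apply: ideal_ext; first exact: sub_ideal1.
  apply: ideal_span_sub => _ ->.
  suff: ideal_set (principal_ideal (-1)) ((-1) * (-1) : R) by rewrite mulrNN mulr1.
  by apply: (ideal_closedM (idealP _)); exact: sub_ideal_span.
- apply: ideal_ext.
    apply: ideal_span_sub => _ ->.
    by apply: mem_ideal_mul; exact: sub_ideal_span.
  by apply: ideal_mul_span_sub => _ _ -> ->; exact: sub_ideal_span.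
- apply/ideal_le_sub; apply: ideal_span_sub => _ ->.
  apply: (ideal_closedD (idealP _)).
    by apply: ideal_addl; exact: sub_ideal_span.
  by apply: ideal_addr; exact: sub_ideal_span.
Qed.

Definition noetherian (R : comPzRingType) : Prop :=
  forall I : ideal R, exists s : seq R, I = ideal_span [set` s].

(* Main.v *)
Require Import Defs.
From HB Require Import structures.
From mathcomp Require Import all_boot all_order all_algebra.
From mathcomp Require Import mathcomp_extra boolp classical_sets functions.
From mathcomp Require Import cardinality.

Set Implicit Arguments.
Unset Strict Implicit.
Unset Printing Implicit Defensive.

Import GRing.Theory.
Local Open Scope ring_scope.

(* For a positive valuation v and fixed a, b, c, the set of all x with
   c <= a v(x) b is an ideal.  Hence the infimum of v over an ideal equals the
   infimum over any generating set, and this remains true after multiplying by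
   fixed factors.  The map phi must send I to the infimum of v over I; it exists
   by completeness in (1), and as a finite sum over generators in (2).  All its
   properties follow by comparing the lower bounds of both sides. *)

Section IdempotentOrder.
Variable G : idemSemiRingType.
Implicit Types a b c d : G.

Lemma idem_le_refl a : idem_le a a.
Proof. exact: addr_idem. Qed.

Lemma idem_le_trans b a c : idem_le a b -> idem_le b c -> idem_le a c.
Proof. by rewrite /idem_le => ab bc; rewrite -{1}ab -addrA bc. Qed.

(** Antisymmetry, by testing [c = a] and [c = b]. It turns every equation below into a comparison of
    lower bounds. *)
Lemma idem_le_eq a b : (forall c, idem_le c a <-> idem_le c b) -> a = b.
Proof.
move=> H; have := (H a).1 (idem_le_refl a); have := (H b).2 (idem_le_refl b).
by rewrite /idem_le addrC => -> .
Qed.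

Lemma idem_leDl a b : idem_le (a + b) a.
Proof. by rewrite /idem_le addrAC addr_idem. Qed.

Lemma idem_leDr a b : idem_le (a + b) b.
Proof. by rewrite addrC; exact: idem_leDl. Qed.

Lemma idem_le_add c a b : idem_le c (a + b) <-> idem_le c a /\ idem_le c b.
Proof.
split=> [cab|[ca cb]]; last by rewrite /idem_le addrA ca.
by split; apply: idem_le_trans cab _; [exact: idem_leDl|exact: idem_leDr].
Qed.

Lemma idem_le0 c : idem_le c 0.
Proof. exact: addr0. Qed.

Lemma idem_leM a b c d : idem_le a b -> idem_le c d -> idem_le (a * c) (b * d).
Proof.
move=> ab cd; apply: (@idem_le_trans (b * c)).
  by rewrite /idem_le -mulrDl ab.
by rewrite /idem_le -mulrDr cd.
Qed.

Lemma idem_le_sum (T : eqType) (s : seq T) (F : T -> G) c :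
  idem_le c (\sum_(x <- s) F x) <-> {in s, forall x, idem_le c (F x)}.
Proof.
elim: s => [|x s IHs]; first by rewrite big_nil; split=> // _; exact: idem_le0.
rewrite big_cons idem_le_add IHs; split=> [[cx cs] y|cs].
  by rewrite inE => /predU1P[->|/cs].
by split=> [|y ys]; apply: cs; rewrite inE ?eqxx ?ys ?orbT.
Qed.

End IdempotentOrder.

Lemma idem_le_bigsum (K : Type) (G : completeSemiRingType K) (I : Type)
    (IK : ([set: I] #<= [set: K])%card) (b : I -> G) c :
  idem_le c (bigsum I b) <-> forall i, idem_le c (b i).
Proof.
split=> [cb i|]; last exact: bigsum_glb.
exact: idem_le_trans cb (bigsum_lb _ IK b i).
Qed.

(** Makes the family of all elements of an ideal of [R] small enough for an [R]-complete sum. *)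
Lemma card_sig_le (T : Type) (A : set T) :
  ([set: {x : T | A x}] #<= [set: T])%card.
Proof.
have sval_inj : set_inj [set: {x : T | A x}] sval.
  move=> [x Ax] [y Ay] _ _ /= xy; rewrite {}xy in Ax *.
  by congr exist; exact: Prop_irrelevance.
have := inj_card_eq sval_inj; rewrite card_eq_sym => /card_eqPle[+ _].
by move=> /card_le_trans; apply; exact: subset_card_le.
Qed.

Section PositiveValuation.
Variables (R : comPzRingType) (G : idemSemiRingType) (v : R -> G).
Hypothesis v_pos : positive_valuation v.
Implicit Types I J : ideal R.

Let v_val : valuation v := v_pos.1.

(** At zero the right side is 0, the greatest element. Sums use that [v x + v y] is below
    [v (x + y)]. Multiples use positivity: [v x = 1 * v x] is below [v r * v x]. *)
Lemma ideal_closed_valuation_ge a b c :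
  ideal_closed [set x : R | idem_le c (a * v x * b)].
Proof.
split=> [|x y cx cy|r x cx] /=.
- by rewrite valuation0 // mulr0 mul0r; exact: idem_le0.
- apply: (@idem_le_trans _ (a * (v x + v y) * b)).
    by rewrite mulrDr mulrDl; apply/idem_le_add.
  apply: idem_leM (idem_le_refl b); apply: idem_leM (idem_le_refl a) _.
  exact: valuationD.
- apply: (idem_le_trans cx); rewrite valuationM // -{1}[v x]mul1r.
  apply: idem_leM (idem_le_refl b); apply: idem_leM (idem_le_refl a) _.
  exact: idem_leM (v_pos.2 r) (idem_le_refl _).
Qed.

Lemma ideal_span_valuation_ge (A : set R) a b c :
  (forall x, ideal_set (ideal_span A) x -> idem_le c (a * v x * b)) <->
  (forall x, A x -> idem_le c (a * v x * b)).
Proof.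
split=> H x; first by move=> /sub_ideal_span; exact: H.
exact: (@ideal_span_sub _ _ (Ideal (ideal_closed_valuation_ge a b c)) H).
Qed.

(* The factors a and b make this an infimum that commutes with
   multiplication. *)
Definition ideal_infimum (phi : ideal R -> G) :=
  forall I a b c, idem_le c (a * phi I * b) <->
    forall x, ideal_set I x -> idem_le c (a * v x * b).

Variable phi : ideal R -> G.
Hypothesis phiP : ideal_infimum phi.

Lemma ideal_infimum_ge I c :
  idem_le c (phi I) <-> forall x, ideal_set I x -> idem_le c (v x).
Proof.
have := phiP I 1 1 c; rewrite mul1r mulr1 => ->.
by split=> H x /H; rewrite mul1r mulr1.
Qed.

Lemma ideal_infimum_span (A : set R) c :
  idem_le c (phi (ideal_span A)) <-> forall x, A x -> idem_le c (v x).
Proof.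
have := phiP (ideal_span A) 1 1 c.
rewrite mul1r mulr1 ideal_span_valuation_ge => ->.
by split=> H x /H; rewrite mul1r mulr1.
Qed.

Lemma ideal_infimum_principal x : phi (principal_ideal x) = v x.
Proof.
by apply: idem_le_eq => c; rewrite ideal_infimum_span; split=> [|cx _ ->//]; apply.
Qed.

(** The union of the [F t] generates the sum, so lower bounds can be tested on each [F t]. Taking
    [T] to be [bool] gives additivity; the same lemma gives preservation of complete sums. *)
Lemma ideal_infimum_sum (T : Type) (F : T -> ideal R) c :
  idem_le c (phi (ideal_sum F)) <-> forall t, idem_le c (phi (F t)).
Proof.
rewrite ideal_infimum_span; split=> [H t|H x [t _ Fx]].
  by apply/ideal_infimum_ge => x Fx; apply: H; exists t.
exact: (ideal_infimum_ge (F t) c).1 (H t) x Fx.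
Qed.

Lemma ideal_infimum0 : phi 0 = 0.
(* The zero ideal is [principal_ideal 0] by definition, and the unit ideal below is
   [principal_ideal 1]. *)
Proof. by rewrite -(valuation0 v_val); exact: ideal_infimum_principal. Qed.

Lemma ideal_infimum1 : phi 1 = 1.
Proof. by rewrite -(valuation1 v_val); exact: ideal_infimum_principal. Qed.

Lemma ideal_infimumD I J : phi (I + J) = phi I + phi J.
Proof.
apply: idem_le_eq => c; rewrite [I + J]ideal_add_sum ideal_infimum_sum.
rewrite idem_le_add; split=> [H|[cI cJ] []//].
by split; [exact: (H true)|exact: (H false)].
Qed.

(** The products [x * y] generate [I * J]. The infimum over [I] is tested with right factor [phi J],
    then the one over [J] with left factor [v x]. *)
Lemma ideal_infimumM I J : phi (I * J) = phi I * phi J.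
Proof.
apply: idem_le_eq => c; rewrite ideal_infimum_span.
have := phiP I 1 (phi J) c; rewrite mul1r => ->; split=> [H x Ix|H _ [x Ix [y Jy <-]]].
  have := phiP J (v x) 1 c; rewrite mul1r mulr1 => -> y Jy.
  by rewrite mulr1 -valuationM //; apply: H; exists x => //; exists y.
have := phiP J (v x) 1 c; rewrite mulr1 -{1}[v x]mul1r => /iffLR/(_ (H x Ix)).
by move=> /(_ y Jy); rewrite mulr1 -valuationM.
Qed.

Lemma ideal_infimum_rmorphism :
  exists f : {rmorphism ideal R -> G}, f =1 phi.
Proof.
pose f : {rmorphism ideal R -> G} := HB.pack phi
  (GRing.isNmodMorphism.Build _ _ phi (conj ideal_infimum0 ideal_infimumD))
  (GRing.isMonoidMorphism.Build _ _ phi (conj ideal_infimum1 ideal_infimumM)).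
by exists f.
Qed.

End PositiveValuation.

(** For uniqueness in (1): indexing by the elements of [I] keeps the sum within size |R|. *)
Lemma ideal_sum_principal (R : comPzRingType) (I : ideal R) :
  I = ideal_sum (fun x : {x : R | ideal_set I x} => principal_ideal (sval x)).
Proof.
apply: ideal_ext => [x Ix|].
  by apply: (ideal_sum_ub (t := exist _ x Ix)); exact: sub_ideal_span.
by apply: ideal_sum_sub => -[x Ix]; apply: ideal_span_sub => _ ->.
Qed.

(** For uniqueness in (2): on a finitely generated ideal, additivity alone reduces a morphism to
    principal ideals. *)
Lemma ideal_span_seq (R : comPzRingType) (s : seq R) :
  ideal_span [set` s]%classic = \sum_(x <- s) principal_ideal x.
Proof.
apply: idem_le_eq => I; rewrite idem_le_sum ideal_le_sub.
split=> [sI x xs|sI]; last first.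
  apply: ideal_span_sub => x /sI /ideal_le_sub; apply.
  exact: sub_ideal_span.
apply/ideal_le_sub; apply: ideal_span_sub => _ ->.
by apply: sI; exact: sub_ideal_span.
Qed.

Lemma bigsum_ideal_infimum (R : comPzRingType) (G : completeSemiRingType R)
    (v : R -> G) :
  ideal_infimum v (fun I : ideal R => bigsum {x : R | ideal_set I x} (v \o sval)).
Proof.
move=> I a b c.
rewrite (mulr_bigsumr _ (card_sig_le I)) (mulr_bigsuml _ (card_sig_le I)).
rewrite (idem_le_bigsum (card_sig_le I)).
by split=> [H x Ix|H [x Ix]]; [exact: (H (exist _ x Ix))|exact: H].
Qed.

Lemma sum_ideal_infimum (R : comPzRingType) (G : idemSemiRingType)
    (v : R -> G) (gens : ideal R -> seq R) :
  positive_valuation v -> (forall I, I = ideal_span [set` gens I]%classic) ->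
  ideal_infimum v (fun I => \sum_(x <- gens I) v x).
Proof.
move=> v_pos gensP I a b c; rewrite mulr_sumr mulr_suml idem_le_sum.
(* Only the ideal on the right is rewritten as a span; the [I] inside [gens I] stays. *)
by rewrite {2}(gensP I) (ideal_span_valuation_ge v_pos).
Qed.

Theorem corollary4p21 (R : comPzRingType) :
  (forall (G : completeSemiRingType R) (v : R -> G),
     positive_valuation v ->
     exists phi : {rmorphism ideal R -> G},
       [/\ preserves_bigsum (K := R) phi,
           v =1 phi \o @principal_ideal R
         & forall psi : {rmorphism ideal R -> G},
             preserves_bigsum (K := R) psi ->
             v =1 psi \o @principal_ideal R ->
             psi =1 phi])
  /\
  (noetherian R ->
   forall (G : idemSemiRingType) (v : R -> G),
     positive_valuation v ->
     exists phi : {rmorphism ideal R -> G},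
       v =1 phi \o @principal_ideal R /\
       forall psi : {rmorphism ideal R -> G},
         v =1 psi \o @principal_ideal R ->
         psi =1 phi).
Proof.
split=> [G v v_pos|R_noeth G v v_pos].
- have phiP := bigsum_ideal_infimum v.
  have [phi phiE] := ideal_infimum_rmorphism v_pos phiP.
  exists phi; split=> [T TR F|x|psi psi_sum psiE I].
  + apply: idem_le_eq => c; rewrite (idem_le_bigsum TR) phiE.
    by rewrite (ideal_infimum_sum v_pos phiP); under eq_forall do rewrite -phiE.
  + by rewrite /= phiE (ideal_infimum_principal v_pos phiP).
  (* Only the argument of [psi] is expanded, so both sides become sums of [v] over the elements of
     [I]. *)
  + rewrite phiE {1}(ideal_sum_principal I) [LHS]psi_sum ?card_sig_le//.
    by congr bigsum; apply: funext => x; rewrite /= psiE.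
(* The chosen generators do not affect the value of [phi], which is the infimum over the whole
   ideal. *)
- have [gens gensP] := choice R_noeth.
  have phiP := sum_ideal_infimum v_pos gensP.
  have [phi phiE] := ideal_infimum_rmorphism v_pos phiP.
  exists phi; split=> [x|psi psiE I].
    by rewrite /= phiE (ideal_infimum_principal v_pos phiP).
  rewrite phiE {1}(gensP I) ideal_span_seq rmorph_sum.
  by apply: eq_bigr => x _; rewrite psiE.
Qed.
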